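(* Let $\tau=(\tau_{iq})_{1\le i\le n,1\le q\le Q}$ be given with $\tau_{iq}\in[0,1]$ and $\sum_{q}\tau_{iq}=1$ for all $i$, and let $Y=(Y_{i_1,\dots,i_m})$ be an observed hypergraph. Then the values $(\widehat\pi_q,\widehat B^{(m)}_{q_1,\dots,q_m})_{q,\,2\le m\le M,\,q_1\le\dots\le q_m}$ maximizing $\theta\mapsto\mathcal J(\theta,\tau)$, over all parameters $\theta=(\pi_q,B^{(m)}_{q_1,\dots,q_m})$ of the hypergraph stochastic blockmodel with $Q$ groups, under the constraint $\sum_q\pi_q=1$, are given by $$\widehat\pi_q=\frac1n\sum_{i=1}^n\tau_{iq}\qquad\text{and}\qquad\widehat B^{(m)}_{q_1,\dots,q_m}=\frac{\sum_{(i_1,\dots,i_m)\in\mathcal V^m}\tau_{i_1q_1}\cdots\tau_{i_mq_m}\,Y_{i_1,\dots,i_m}}{\sum_{(i_1,\dots,i_m)\in\mathcal V^m}\tau_{i_1q_1}\cdots\tau_{i_mq_m}},$$ provided the denominators are nonzero.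
   Context: Nodes are $\mathcal V=\{1,\dots,n\}$, and $\mathcal V^m$ denotes the set of ordered $m$-tuples $(i_1,\dots,i_m)$ of pairwise distinct nodes. A simple hypergraph with hyperedge sizes between $2$ and $M$ is encoded by indicators $Y_{i_1,\dots,i_m}\in\{0,1\}$ indexed by the $m$-subsets $\{i_1,\dots,i_m\}$ of the nodes, $2\le m\le M$ (the value does not depend on the order of the indices). Hypergraph stochastic blockmodel with parameter $\theta=(\pi_q,B^{(m)}_{q_1,\dots,q_m})$: $Z_1,\dots,Z_n$ are i.i.d. latent variables in $\{1,\dots,Q\}$ with $\mathbb P_\theta(Z_i=q)=\pi_q$, $\pi_q\ge 0$, $\sum_q\pi_q=1$; given $Z=(Z_1,\dots,Z_n)$ the indicators are independent, $Y_{i_1,\dots,i_m}$ being Bernoulli with parameter $B^{(m)}_{Z_{i_1},\dots,Z_{i_m}}$, where each tensor $B^{(m)}$ has entries in $[0,1]$ and is fully symmetric in its $m$ indices (hence parametrized by its values for $q_1\le\dots\le q_m$). Given $\tau$, $\mathbb Q_\tau$ is the distribution on $\{1,\dots,Q\}^n$ under which $Z_1,\dots,Z_n$ are independent with $\mathbb Q_\tau(Z_i=q)=\tau_{iq}$. The evidence lower bound is $$\mathcal J(\theta,\tau)=\mathbb E_{\mathbb Q_\tau}[\log\mathbb P_\theta(Y,Z)]-\mathbb E_{\mathbb Q_\tau}[\log\mathbb Q_\tau(Z)],$$ where $\mathbb P_\theta(Y,Z)$ is the joint probability of the observed $Y$ and of $Z$; conventions: $\log 0=-\infty$, $0\cdot\log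 0=0$. *)

(* Defs.v *)
From mathcomp Require Import all_boot all_order all_algebra.
From mathcomp Require Import all_classical all_reals all_analysis.

Set Implicit Arguments.
Unset Strict Implicit.
Unset Printing Implicit Defensive.

Import Order.TTheory GRing.Theory Num.Theory.
Local Open Scope ring_scope.

(* Nodes are 'I_n and groups are 'I_Q.  A hypergraph is a family of indicators
   Y : {set 'I_n} -> bool, one per node subset; only the values on subsets e
   with 2 <= #|e| <= M are ever used. *)

(* [conn theta m q] is B^(m)_(q_1, ..., q_m); only 2 <= m <= M is meaningful. *)
Record hsbm_param (R : realType) (Q : nat) := HsbmParam {
  prop : 'I_Q -> R;
  conn : forall m : nat, m.-tuple 'I_Q -> R
}.

Definition is_hsbm_param (R : realType) (Q M : nat) (theta : hsbm_param R Q)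
    : Prop :=
  [/\ forall q, 0 <= prop theta q,
      \sum_q prop theta q = 1,
      forall m (q : m.-tuple 'I_Q), (2 <= m <= M)%N ->
        0 <= conn theta q <= 1
    & forall m (q r : m.-tuple 'I_Q), (2 <= m <= M)%N ->
        perm_eq q r -> conn theta q = conn theta r].

Section Model.
Variables (R : realType) (n Q M : nat).
Implicit Types (theta : hsbm_param R Q) (Y : {set 'I_n} -> bool).
Implicit Types (z : {ffun 'I_n -> 'I_Q}) (tau : 'M[R]_(n, Q)).

Definition latent_prob theta z : R := \prod_i prop theta (z i).

(* The groups of the nodes of e are listed in the enumeration order of e; by
   symmetry of [conn theta] this choice is immaterial. *)
Definition cond_prob theta Y z : R :=
  \prod_(e : {set 'I_n} | (2 <= #|e| <= M)%N)
    bernoulli_pmf (conn theta [tuple of [seq z i | i in e]]) (Y e).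

Definition joint_prob theta Y z : R := latent_prob theta z * cond_prob theta Y z.

Definition var_prob tau z : R := \prod_i tau i (z i).

(* Expectations are extended-real valued: [lne 0 = -oo] and [0 * -oo = 0]. *)
Definition var_expectation tau (f : {ffun 'I_n -> 'I_Q} -> \bar R) : \bar R :=
  (\sum_z (var_prob tau z)%:E * f z)%E.

Definition elbo Y tau theta : \bar R :=
  (var_expectation tau (fun z => lne (joint_prob theta Y z)%:E)
   - var_expectation tau (fun z => lne (var_prob tau z)%:E))%E.

Definition maximizes_elbo Y tau theta : Prop :=
  is_hsbm_param M theta /\
  forall theta', is_hsbm_param M theta' ->
    (elbo Y tau theta' <= elbo Y tau theta)%E.

Definition tau_weight tau m (q : m.-tuple 'I_Q) (i : m.-tuple 'I_n) : R :=
  \prod_(k < m) tau (tnth i k) (tnth q k).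

(* The sums range over the ordered m-tuples of pairwise distinct nodes. *)
Definition conn_num Y tau m (q : m.-tuple 'I_Q) : R :=
  \sum_(i : m.-tuple 'I_n | uniq i) tau_weight tau q i * (Y [set j in i])%:R.

Definition conn_den tau m (q : m.-tuple 'I_Q) : R :=
  \sum_(i : m.-tuple 'I_n | uniq i) tau_weight tau q i.

End Model.

(* Main.v *)
(* By ln x <= x - 1, with equality only at x = 1, the expected log-likelihood
   ratio of theta against the closed-form parameter is at most the expected sum
   of (ratio - 1) over all factors of the joint probability.  Because theta-hat
   has the ratios of expected counts as entries, this linearized sum is <= 0.
   In the equality case all factors agree on the support of Q_tau, which
   determines the proportions and every connectivity entry with a nonzero
   denominator.  Sums over m-subsets are turned into sums over ordered m-tuples
   of distinct nodes, each subset being counted m! times, so the connectivity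
   entries are never grouped into orbits under permutation of the indices. *)
Require Import Defs.
From mathcomp Require Import all_boot all_order all_algebra.
From mathcomp Require Import perm ring lra.
From mathcomp Require Import all_classical all_reals all_analysis.

Set Implicit Arguments.
Unset Strict Implicit.
Unset Printing Implicit Defensive.

Import Order.TTheory GRing.Theory Num.Theory.
Local Open Scope ring_scope.

(** * Logarithmic inequalities and the comparison of Bernoulli parameters *)

Section LogRatio.
Variable R : realType.

Lemma ln_leB1 (x : R) : 0 < x -> ln x <= x - 1.
Proof. by move=> x0; rewrite lerBrDl -{2}(lnK x0) expR_ge1Dx. Qed.

Lemma ln_eqB1 (x : R) : 0 < x -> ln x = x - 1 -> x = 1.
Proof.
move=> x0 lnx; have [/eqP|/expR_gt1Dx] := eqVneq (ln x) 0.
  by rewrite ln_eq0// => /eqP.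
by rewrite lnK// lnx subrKC ltxx.
Qed.

Lemma ln_prod (I : finType) (P : pred I) (F : I -> R) :
  (forall i, P i -> 0 < F i) ->
  ln (\prod_(i | P i) F i) = \sum_(i | P i) ln (F i).
Proof.
move=> F0; rewrite (eq_bigr (fun i => expR (ln (F i)))) => [|i Pi].
  by rewrite -expR_sum expRK.
by rewrite lnK// posrE F0.
Qed.

Section Families.
Variables (I : finType) (P : pred I) (F G : I -> R).
Hypotheses (F_gt0 : forall i, P i -> 0 < F i) (G_gt0 : forall i, P i -> 0 < G i).

Let ratio_gt0 i : P i -> 0 < F i / G i.
Proof. by move=> Pi; rewrite divr_gt0 ?F_gt0 ?G_gt0. Qed.

Let ln_prodB : ln (\prod_(i | P i) F i) - ln (\prod_(i | P i) G i) =
  \sum_(i | P i) ln (F i / G i).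
Proof.
rewrite !ln_prod// -sumrB; apply: eq_bigr => i Pi.
by rewrite ln_div ?posrE ?F_gt0 ?G_gt0.
Qed.

Lemma ln_prodB_le : ln (\prod_(i | P i) F i) - ln (\prod_(i | P i) G i) <=
  \sum_(i | P i) (F i / G i - 1).
Proof. by rewrite ln_prodB; apply: ler_sum => i Pi; rewrite ln_leB1 ?ratio_gt0. Qed.

(** The gaps [x - 1 - ln x] at the ratios are nonnegative and sum to zero, so each vanishes and each
    ratio is 1. *)
Lemma ln_prodB_eq : ln (\prod_(i | P i) F i) - ln (\prod_(i | P i) G i) =
  \sum_(i | P i) (F i / G i - 1) -> forall i, P i -> F i = G i.
Proof.
rewrite ln_prodB => /esym/eqP; rewrite -subr_eq0 -sumrB => /eqP eq0 i Pi.
have /psumr_eq0P/(_ eq0 i Pi)/eqP : forall i, P i ->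
    0 <= F i / G i - 1 - ln (F i / G i).
  by move=> j Pj; rewrite subr_ge0 ln_leB1 ?ratio_gt0.
by rewrite subr_eq0 => /eqP/esym/(ln_eqB1 (ratio_gt0 Pi))/divr1_eq.
Qed.

End Families.

(** Equality holds when [a] and [d] are nonzero. For [a = 0] the left side is 0 by the convention on
    division by zero, whence only an inequality. *)
Lemma mul_div_ratio_le (a d b : R) : 0 <= a -> 0 <= d -> 0 <= b ->
  a * (b / (a / d)) <= d * b.
Proof.
move=> a0 d0 b0; have [->|an0] := eqVneq a 0; first by rewrite mul0r mulr_ge0.
have [->|dn0] := eqVneq d 0; first by rewrite invr0 mulr0 invr0 !mulr0 mul0r.
by rewrite le_eqVlt; apply/orP; left; apply/eqP; field; rewrite an0 dn0.
Qed.

(** With [a] and [d - a] the expected counts of ones and zeros, the two ratio terms are at most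
    [d * b] and [d * (1 - b)]; their sum [d] is cancelled by the subtracted counts. *)
Lemma bernoulli_ratio_le0 (a d b : R) : 0 <= a <= d -> 0 <= b <= 1 ->
  a * (b / (a / d) - 1) + (d - a) * ((1 - b) / (1 - a / d) - 1) <= 0.
Proof.
move=> /andP[a0 ad] /andP[b0 b1].
have d0 : 0 <= d := le_trans a0 ad.
have [dE|dn0] := eqVneq d 0.
  have -> : a = 0 by apply/eqP; rewrite eq_le a0 -dE ad.
  by rewrite dE subrr !mul0r addr0.
have -> : 1 - a / d = (d - a) / d by rewrite mulrBl divff.
have := mul_div_ratio_le a0 d0 b0.
have := @mul_div_ratio_le (d - a) d (1 - b).
rewrite !subr_ge0 => /(_ ad d0 b1); lra.
Qed.

End LogRatio.

(** * Node subsets and ordered tuples of distinct nodes *)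

Lemma perm_eq_enum_set (T : finType) (s : seq T) :
  uniq s -> perm_eq (enum [set j in s]) s.
Proof.
by move=> us; apply: uniq_perm; rewrite ?enum_uniq// => j; rewrite mem_enum inE.
Qed.

Lemma card_set_uniq (T : finType) (m : nat) (i : m.-tuple T) :
  uniq i -> #|[set j in i]| = m.
Proof. by move=> ui; rewrite cardsE (card_uniqP ui) size_tuple. Qed.

Lemma sum_uniq_tuple_set (T : finType) (V : nmodType) (m : nat)
    (f : {set T} -> V) :
  \sum_(i : m.-tuple T | uniq i) f [set j in i] =
  (\sum_(e : {set T} | #|e| == m) f e) *+ m`!.
Proof.
rewrite (partition_big (fun i : m.-tuple T => [set j in i])
  (fun e => #|e| == m)) => [|i ui]; last by rewrite card_set_uniq.
rewrite -sumrMnl; apply: eq_bigr => e /eqP em.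
rewrite (eq_bigr (fun=> f e)) => [|i /andP[_ /eqP->]//].
(* Here m! is read as the falling factorial counting duplicate-free m-tuples with entries in [e];
   since [e] has m elements, such a tuple exhausts it. *)
rewrite -ffactnn -[X in X ^_ _]em -card_uniq_tuples -sumr_const.
apply: eq_bigl => i; rewrite inE andbC.
have [ui|_] := boolP (uniq i); last by rewrite !andbF.
rewrite !andbT eqEcard card_set_uniq// em leqnn andbT.
by apply/fintype.subsetP/allP => ie j; have := ie j; rewrite inE.
Qed.

(** * Connectivity entries indexed by tuples whose lengths are only provably equal *)

Section Conn.
Variables (R : realType) (Q : nat).
Implicit Type theta : hsbm_param R Q.

Lemma conn_in_tuple theta m (q : m.-tuple 'I_Q) :
  conn theta (in_tuple q) = conn theta q.
Proof.
case: q => s sm /=; have mE := eqP sm; subst m.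
by congr (conn theta _); apply: val_inj.
Qed.

Lemma conn_perm M theta k m (p : k.-tuple 'I_Q) (q : m.-tuple 'I_Q) :
  is_hsbm_param M theta -> (2 <= m <= M)%N -> perm_eq p q ->
  conn theta p = conn theta q.
Proof.
move=> [_ _ _ sym] mM pq; have km : k = m.
  by rewrite -(size_tuple p) -(size_tuple q); apply: perm_size.
by subst k; apply: sym.
Qed.

End Conn.

(** * Marginals of the variational distribution *)

Section Estimator.
Variables (R : realType) (n Q M : nat) (tau : 'M[R]_(n, Q)).
Variable Y : {set 'I_n} -> bool.
Hypotheses (n_gt0 : (0 < n)%N) (tau01 : forall i q, 0 <= tau i q <= 1).
Hypothesis tau_sum1 : forall i, \sum_q tau i q = 1.

Let tau_ge0 i q : 0 <= tau i q.
Proof. by case/andP: (tau01 i q). Qed.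

Lemma tau_weight_ge0 m (q : m.-tuple 'I_Q) i : 0 <= tau_weight tau q i.
Proof. exact: prodr_ge0. Qed.

Lemma var_prob_ge0 z : 0 <= var_prob tau z.
Proof. exact: prodr_ge0. Qed.

Lemma var_prob_gt0 z i : 0 < var_prob tau z -> 0 < tau i (z i).
Proof.
rewrite /var_prob (bigD1 i)//= lt_neqAle eq_sym mulf_eq0 negb_or.
by move=> /andP[/andP[tn0 _] _]; rewrite lt_def tn0 tau_ge0.
Qed.

(** Independence at distinct nodes: the event is a product of one constraint per node, so the sum
    over labellings factors node by node. *)
Lemma sum_var_prob_fiber m (i : m.-tuple 'I_n) (q : m.-tuple 'I_Q) : uniq i ->
  \sum_(z : {ffun 'I_n -> 'I_Q} | map_tuple z i == q) var_prob tau z =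
  tau_weight tau q i.
Proof.
move=> ui.
(* The constraint on node [j]: vacuous outside [i], otherwise the group prescribed at the position
   of [j], which is unique as [i] has no duplicates. *)
pose c j r := (j \in i) ==> (r == nth r q (index j i)).
have idx k : index (tnth i k) i = k.
  by rewrite (tnth_nth (tnth i k)) index_uniq// size_tuple.
have cE k r : c (tnth i k) r = (r == tnth q k).
  by rewrite /c mem_tnth idx /= -tnth_nth.
transitivity (\sum_(z : {ffun 'I_n -> 'I_Q})
    \prod_j (tau j (z j) * (c j (z j))%:R)).
  rewrite big_mkcond; apply: eq_bigr => z _; rewrite big_split/=.
  case: ifPn => [/eqP zq|zq].
    rewrite [X in _ * X]big1 ?mulr1// => j _.
    have [ji|ji] := boolP (j \in i); last by rewrite /c (negbTE ji).
    by have [k ->] := tnthP _ _ ji; rewrite cE -zq tnth_map eqxx.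
  have [k kP] : exists k, ~~ c (tnth i k) (z (tnth i k)).
    apply/existsP; rewrite -negb_forall; apply: contra zq => /forallP ck.
    by apply/eqP/eq_from_tnth => k; have := ck k; rewrite cE tnth_map => /eqP.
  by rewrite [X in _ * X](bigD1 (tnth i k))//= (negbTE kP) mul0r mulr0.
rewrite -(bigA_distr_bigA (fun j r => tau j r * (c j r)%:R)) /=.
(* An unconstrained node contributes the total mass 1 of its row of [tau]. *)
rewrite (bigID (mem i))/= [X in _ * X]big1 ?mulr1 => [|j ji]; last first.
  rewrite -[RHS](tau_sum1 j); apply: eq_bigr => r _.
  by rewrite /c (negbTE ji) mulr1.
rewrite -big_uniq// big_tuple; apply: eq_bigr => k _.
rewrite (bigD1 (tnth q k))//= cE eqxx mulr1 big1 ?addr0// => r rq.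
by rewrite cE (negbTE rq) mulr0.
Qed.

Lemma sum_var_prob_comp m (i : m.-tuple 'I_n) (h : m.-tuple 'I_Q -> R) :
  uniq i ->
  \sum_z var_prob tau z * h (map_tuple z i) = \sum_q tau_weight tau q i * h q.
Proof.
move=> ui; rewrite (partition_big (fun z : {ffun 'I_n -> 'I_Q} => map_tuple z i)
  predT)//=.
apply: eq_bigr => q _; rewrite -sum_var_prob_fiber// mulr_suml.
by apply: eq_bigr => z /eqP ->.
Qed.

Lemma sum_var_prob_node i (h : 'I_Q -> R) :
  \sum_z var_prob tau z * h (z i) = \sum_q tau i q * h q.
Proof.
rewrite (partition_big (fun z : {ffun 'I_n -> 'I_Q} => z i) predT)//=.
apply: eq_bigr => q _; have -> : tau i q = tau_weight tau [tuple q] [tuple i].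
  by rewrite /tau_weight big_ord1.
rewrite -sum_var_prob_fiber// mulr_suml.
apply: eq_big => [z|z /eqP->//].
by apply/eqP/eqP => [<-|/(congr1 val)[]//]; apply: val_inj.
Qed.

Lemma exists_var_prob_gt0 m (i : m.-tuple 'I_n) (q : m.-tuple 'I_Q) :
  uniq i -> 0 < tau_weight tau q i ->
  exists2 z, 0 < var_prob tau z & map_tuple z i = q.
Proof.
move=> ui; rewrite -sum_var_prob_fiber// => /lt0r_neq0/eqP.
case/psumr_neq0P => [z _|z /andP[/eqP zq z0]]; first exact: var_prob_ge0.
by exists z.
Qed.

(** * Symmetry and bounds of the expected counts, and the closed-form parameter *)

(** Permuting the positions of the node tuples by the permutation linking [q] to [r] is a bijection
    that keeps node sets and turns the weights for [q] into those for [r]. *)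
Lemma tau_weight_sum_perm (f : {set 'I_n} -> R) m (q r : m.-tuple 'I_Q) :
  perm_eq q r ->
  \sum_(i : m.-tuple 'I_n | uniq i) tau_weight tau q i * f [set j in i] =
  \sum_(i : m.-tuple 'I_n | uniq i) tau_weight tau r i * f [set j in i].
Proof.
case/tuple_permP => p qE.
pose h (i : m.-tuple 'I_n) := [tuple tnth i (p k) | k < m].
have h_inj : injective h.
  move=> i j /(congr1 (fun t : m.-tuple _ => tnth t)) ij.
  apply: eq_from_tnth => k.
  by move: (congr1 (@^~ (p^-1 k)%g) ij); rewrite !tnth_mktuple permKV.
have hP i : perm_eq (h i) i by apply/tuple_permP; exists p.
rewrite (reindex_inj h_inj); apply: eq_big => [i|i _]; first exact: perm_uniq.
congr (_ * f _); last by apply/setP => j; rewrite !inE (perm_mem (hP i)).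
rewrite /tau_weight [RHS](reindex_inj (@perm_inj _ p)).
have -> : q = [tuple tnth r (p k) | k < m] by apply: val_inj.
by apply: eq_bigr => k _; rewrite !tnth_mktuple.
Qed.

Lemma conn_num_perm m (q r : m.-tuple 'I_Q) :
  perm_eq q r -> conn_num Y tau q = conn_num Y tau r.
Proof. exact: (tau_weight_sum_perm (fun e => (Y e)%:R)). Qed.

Lemma conn_denE m (q : m.-tuple 'I_Q) : conn_den tau q =
  \sum_(i : m.-tuple 'I_n | uniq i) tau_weight tau q i * 1.
Proof. by apply: eq_bigr => i _; rewrite mulr1. Qed.

Lemma conn_den_perm m (q r : m.-tuple 'I_Q) :
  perm_eq q r -> conn_den tau q = conn_den tau r.
Proof. by rewrite !conn_denE; exact: (tau_weight_sum_perm (fun=> 1)). Qed.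

Lemma conn_num_ge0 m (q : m.-tuple 'I_Q) : 0 <= conn_num Y tau q.
Proof. by apply: sumr_ge0 => i _; rewrite mulr_ge0 ?tau_weight_ge0. Qed.

Lemma conn_den_ge0 m (q : m.-tuple 'I_Q) : 0 <= conn_den tau q.
Proof. by apply: sumr_ge0 => i _; exact: tau_weight_ge0. Qed.

Lemma conn_denBnum m (q : m.-tuple 'I_Q) : conn_den tau q - conn_num Y tau q =
  \sum_(i : m.-tuple 'I_n | uniq i) tau_weight tau q i * (~~ Y [set j in i])%:R.
Proof.
rewrite -sumrB; apply: eq_bigr => i _.
by case: (Y _); rewrite ?mulr1 ?mulr0 ?subr0 ?subrr.
Qed.

Lemma conn_num_le_den m (q : m.-tuple 'I_Q) :
  conn_num Y tau q <= conn_den tau q.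
Proof.
rewrite -subr_ge0 conn_denBnum.
by apply: sumr_ge0 => i _; rewrite mulr_ge0 ?tau_weight_ge0.
Qed.

(* Entries whose denominator vanishes are set to 0, since 0^-1 = 0. *)
Definition elbo_argmax : hsbm_param R Q :=
  HsbmParam (fun q => n%:R^-1 * \sum_i tau i q)
    (fun m q => conn_num Y tau q / conn_den tau q).

Lemma is_hsbm_param_argmax : is_hsbm_param M elbo_argmax.
Proof.
split => /= [q||m q _|m q r _ qr].
- by rewrite mulr_ge0 ?invr_ge0// sumr_ge0.
- rewrite -mulr_sumr exchange_big/= (eq_bigr (fun=> 1)) => [|i _]; last first.
    exact: tau_sum1.
  by rewrite sumr_const card_ord mulVf// pnatr_eq0 -lt0n.
- have [d0|dn0] := eqVneq (conn_den tau q) 0.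
    by rewrite d0 invr0 mulr0 lexx ler01.
  have dgt0 : 0 < conn_den tau q by rewrite lt_def dn0 conn_den_ge0.
  by rewrite divr_ge0 ?conn_num_ge0 ?conn_den_ge0//= ler_pdivrMr// mul1r
    conn_num_le_den.
- by rewrite (conn_num_perm qr) (conn_den_perm qr).
Qed.

(** * Positivity of the closed form on the support of the variational distribution *)

Lemma tau_weight_map_gt0 z m (i : m.-tuple 'I_n) : 0 < var_prob tau z ->
  0 < tau_weight tau (map_tuple z i) i.
Proof. by move=> z0; apply: prodr_gt0 => k _; rewrite tnth_map var_prob_gt0. Qed.

Lemma tau_weight_sum_gt0 (f : {set 'I_n} -> bool) m (q : m.-tuple 'I_Q)
    (i : m.-tuple 'I_n) :
  uniq i -> f [set j in i] -> 0 < tau_weight tau q i ->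
  0 < \sum_(i : m.-tuple 'I_n | uniq i) tau_weight tau q i * (f [set j in i])%:R.
Proof.
move=> ui fi w0; rewrite (bigD1 i)//= fi mulr1 ltr_pwDl//.
by apply: sumr_ge0 => j _; rewrite mulr_ge0 ?tau_weight_ge0.
Qed.

Lemma conn_den_map_gt0 z m (i : m.-tuple 'I_n) : uniq i ->
  0 < var_prob tau z -> 0 < conn_den tau (map_tuple z i).
Proof.
move=> ui z0; rewrite conn_denE.
exact: (tau_weight_sum_gt0 (f := xpredT) ui) (tau_weight_map_gt0 i z0).
Qed.

(** The nodes of [e], labelled by [z], themselves contribute a positive weight to the expected count
    of the observed value [Y e]. *)
Lemma bernoulli_argmax_gt0 z (e : {set 'I_n}) : 0 < var_prob tau z ->
  0 < bernoulli_pmf (conn elbo_argmax [tuple of [seq z i | i in e]]) (Y e).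
Proof.
move=> z0; pose i := enum_tuple e.
have ui : uniq i := enum_uniq e.
have -> : [tuple of [seq z i | i in e]] = map_tuple z i by apply: val_inj.
have d0 := conn_den_map_gt0 ui z0; have w0 := tau_weight_map_gt0 i z0.
have ie : [set j in i] = e by apply/setP => j; rewrite inE mem_enum.
rewrite /bernoulli_pmf/=; case: ifPn => Ye.
  by rewrite divr_gt0// (tau_weight_sum_gt0 (f := Y) ui)// ie.
rewrite subr_gt0 ltr_pdivrMr// mul1r -subr_gt0 conn_denBnum.
by rewrite (tau_weight_sum_gt0 (f := fun e => ~~ Y e) ui)// ie.
Qed.

Lemma prop_argmax_gt0 i q : 0 < tau i q -> 0 < prop elbo_argmax q.
Proof.
move=> t0; rewrite mulr_gt0 ?invr_gt0 ?ltr0n//.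
by rewrite (bigD1 i)//= ltr_pwDl ?sumr_ge0.
Qed.

Lemma joint_argmax_gt0 z : 0 < var_prob tau z ->
  0 < joint_prob M elbo_argmax Y z.
Proof.
move=> z0; apply: mulr_gt0.
  by apply: prodr_gt0 => i _; exact: prop_argmax_gt0 (var_prob_gt0 i z0).
by apply: prodr_gt0 => e _; exact: bernoulli_argmax_gt0.
Qed.

(** * The linearized comparison with an arbitrary parameter *)

Section Comparison.
Variable theta : hsbm_param R Q.
Hypothesis thetaP : is_hsbm_param M theta.

(** Indexed by plain sequences, so that group lists of lengths [#|e|] and [m] can be compared
    without casts. *)
Let conn_ratio (q : seq 'I_Q) b :=
  bernoulli_pmf (conn theta (in_tuple q)) b /
  bernoulli_pmf (conn elbo_argmax (in_tuple q)) b - 1.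

Lemma expected_prop_ratio_le0 :
  \sum_z var_prob tau z *
    \sum_i (prop theta (z i) / prop elbo_argmax (z i) - 1) <= 0.
Proof.
have [theta_ge0 theta_sum1 _ _] := thetaP.
pose r q := prop theta q / prop elbo_argmax q - 1.
have -> : \sum_z var_prob tau z * \sum_i r (z i) =
    \sum_q (\sum_i tau i q) * r q.
  under eq_bigr do rewrite mulr_sumr.
  rewrite exchange_big/=; under [RHS]eq_bigr do rewrite mulr_suml.
  rewrite [RHS]exchange_big/=; apply: eq_bigr => i _.
  exact: sum_var_prob_node.
(* These terms bound the expected ones group by group; both parts have total [n]. *)
have sum0 : \sum_q (n%:R * prop theta q - \sum_i tau i q) = 0.
  rewrite sumrB -mulr_sumr theta_sum1 exchange_big/=.
  by rewrite (eq_bigr _ (fun i _ => tau_sum1 i)) sumr_const card_ord mulr1 subrr.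
rewrite -[leRHS]sum0; apply: ler_sum => q _; rewrite mulrBr mulr1 lerD2r.
by rewrite [X in _ / X]mulrC mul_div_ratio_le ?sumr_ge0.
Qed.

Lemma conn_ratio_perm (p q : seq 'I_Q) b : (2 <= size q <= M)%N ->
  perm_eq p q -> conn_ratio p b = conn_ratio q b.
Proof.
move=> qM pq.
have pqE (th : hsbm_param R Q) : is_hsbm_param M th ->
    conn th (in_tuple p) = conn th (in_tuple q).
  by move=> thP; apply: (conn_perm thP qM).
by rewrite /conn_ratio (pqE theta)// (pqE elbo_argmax)//;
  exact: is_hsbm_param_argmax.
Qed.

(** For fixed [q] the ratio depends only on the observed bit, so the sum splits into a Bernoulli
    comparison with counts [conn_num] and [conn_den - conn_num]. *)
Lemma weighted_conn_ratio_le0 m (q : m.-tuple 'I_Q) : (2 <= m <= M)%N ->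
  \sum_(i : m.-tuple 'I_n | uniq i)
    tau_weight tau q i * conn_ratio q (Y [set j in i]) <= 0.
Proof.
move=> mM; have [_ _ conn01 _] := thetaP.
have -> : \sum_(i : m.-tuple 'I_n | uniq i)
      tau_weight tau q i * conn_ratio q (Y [set j in i]) =
    conn_num Y tau q * conn_ratio q true +
    (conn_den tau q - conn_num Y tau q) * conn_ratio q false.
  rewrite conn_denBnum !mulr_suml -big_split; apply: eq_bigr => i _ /=.
  by case: (Y _); rewrite !(mulr1, mulr0, mul0r, addr0, add0r).
rewrite /conn_ratio !conn_in_tuple.
by rewrite bernoulli_ratio_le0 ?conn01// conn_num_ge0 conn_num_le_den.
Qed.

Lemma expected_conn_ratio_size_le0 m : (2 <= m <= M)%N ->
  \sum_z var_prob tau z *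
    \sum_(e : {set 'I_n} | #|e| == m) conn_ratio [seq z i | i in e] (Y e) <= 0.
Proof.
(* Scaling by m! keeps the sign and gives a sum over ordered tuples, where the marginals apply. *)
move=> mM; rewrite -(pmulrn_lle0 _ (fact_gt0 m)) -sumrMnl.
have -> : \sum_z (var_prob tau z * \sum_(e : {set 'I_n} | #|e| == m)
      conn_ratio [seq z i | i in e] (Y e)) *+ m`! =
    \sum_(z : {ffun 'I_n -> 'I_Q}) \sum_(i : m.-tuple 'I_n | uniq i)
      var_prob tau z * conn_ratio (map_tuple z i) (Y [set j in i]).
  apply: eq_bigr => z _; rewrite -mulrnAr -sum_uniq_tuple_set mulr_sumr.
  apply: eq_bigr => i ui; congr (_ * _); apply: conn_ratio_perm.
    by rewrite size_tuple.
  by rewrite perm_map// perm_eq_enum_set.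
rewrite exchange_big/=.
rewrite (eq_bigr (fun i : m.-tuple 'I_n => \sum_(q : m.-tuple 'I_Q)
    tau_weight tau q i * conn_ratio q (Y [set j in i]))) => [|i ui]; last first.
  exact: (sum_var_prob_comp (fun q => conn_ratio q (Y [set j in i]))).
by rewrite exchange_big sumr_le0// => q _; exact: weighted_conn_ratio_le0.
Qed.

Lemma expected_conn_ratio_le0 :
  \sum_z var_prob tau z * \sum_(e : {set 'I_n} | (2 <= #|e| <= M)%N)
    conn_ratio [seq z i | i in e] (Y e) <= 0.
Proof.
have -> : \sum_z var_prob tau z * \sum_(e : {set 'I_n} | (2 <= #|e| <= M)%N)
      conn_ratio [seq z i | i in e] (Y e) =
    \sum_z \sum_(m < M.+1 | (2 <= m)%N) var_prob tau z *
      \sum_(e : {set 'I_n} | #|e| == m) conn_ratio [seq z i | i in e] (Y e).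
  apply: eq_bigr => z _; rewrite -mulr_sumr; congr (_ * _).
  (* Subsets are grouped by size; [inord] is faithful here because sizes are at most [M]. *)
  rewrite (partition_big (fun e : {set 'I_n} => inord #|e| : 'I_M.+1)
    (fun m : 'I_M.+1 => (2 <= m)%N)) => [|e /andP[e2 eM]]; last by rewrite inordK.
  apply: eq_bigr => m m2; apply: eq_bigl => e.
  apply/andP/eqP => [[/andP[_ eM] /eqP <-]|em]; first by rewrite inordK.
  by rewrite em m2 -ltnS ltn_ord inord_val.
rewrite exchange_big sumr_le0// => m m2.
by apply: expected_conn_ratio_size_le0; rewrite m2 -ltnS ltn_ord.
Qed.

Let log_ratio z := ln (joint_prob M theta Y z) - ln (joint_prob M elbo_argmax Y z).

Let linear_ratio z :=
  \sum_i (prop theta (z i) / prop elbo_argmax (z i) - 1) +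
  \sum_(e : {set 'I_n} | (2 <= #|e| <= M)%N) conn_ratio [seq z i | i in e] (Y e).

Lemma expected_linear_ratio_le0 : \sum_z var_prob tau z * linear_ratio z <= 0.
Proof.
rewrite -[leRHS](addr0 0).
rewrite (eq_bigr _ (fun z _ => mulrDr _ _ _)) big_split/= lerD//.
  exact: expected_prop_ratio_le0.
exact: expected_conn_ratio_le0.
Qed.

(** * Pointwise comparison at a labelling of positive probability *)

Section Support.
Variable z : {ffun 'I_n -> 'I_Q}.
Hypotheses (z_gt0 : 0 < var_prob tau z) (joint_gt0 : 0 < joint_prob M theta Y z).

Let prop_ge0 q : 0 <= prop theta q.
Proof. by case: thetaP. Qed.

Let bern_ge0 (e : {set 'I_n}) : (2 <= #|e| <= M)%N ->
  0 <= bernoulli_pmf (conn theta [tuple of [seq z i | i in e]]) (Y e).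
Proof. by case: thetaP => _ _ conn01 _ eM; rewrite bernoulli_pmf_ge0 ?conn01. Qed.

Let latent_gt0 : 0 < latent_prob theta z.
Proof.
rewrite lt_def prodr_ge0// andbT; apply: contraTneq joint_gt0.
by rewrite /joint_prob => ->; rewrite mul0r ltxx.
Qed.

Let cond_gt0 : 0 < cond_prob M theta Y z.
Proof.
rewrite lt_def prodr_ge0// andbT; apply: contraTneq joint_gt0.
by rewrite /joint_prob => ->; rewrite mulr0 ltxx.
Qed.

Let prop_gt0 i : 0 < prop theta (z i).
Proof.
rewrite lt_def prop_ge0 andbT; apply: contraTneq latent_gt0 => p0.
by rewrite /latent_prob (bigD1 i)//= p0 mul0r ltxx.
Qed.

Let bern_gt0 (e : {set 'I_n}) : (2 <= #|e| <= M)%N ->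
  0 < bernoulli_pmf (conn theta [tuple of [seq z i | i in e]]) (Y e).
Proof.
move=> eM; rewrite lt_def bern_ge0// andbT; apply: contraTneq cond_gt0 => p0.
by rewrite /cond_prob (bigD1 e)//= p0 mul0r ltxx.
Qed.

Let prop_argmax_z_gt0 i : 0 < prop elbo_argmax (z i).
Proof. exact: prop_argmax_gt0 (var_prob_gt0 i z_gt0). Qed.

Let linear_ratioE : linear_ratio z =
  \sum_i (prop theta (z i) / prop elbo_argmax (z i) - 1) +
  \sum_(e : {set 'I_n} | (2 <= #|e| <= M)%N)
    (bernoulli_pmf (conn theta [tuple of [seq z i | i in e]]) (Y e) /
     bernoulli_pmf (conn elbo_argmax [tuple of [seq z i | i in e]]) (Y e) - 1).
Proof.
by congr (_ + _); apply: eq_bigr => e _; rewrite /conn_ratio !conn_in_tuple.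
Qed.

Let log_ratioE : log_ratio z =
  (ln (latent_prob theta z) - ln (latent_prob elbo_argmax z)) +
  (ln (cond_prob M theta Y z) - ln (cond_prob M elbo_argmax Y z)).
Proof.
rewrite /log_ratio /joint_prob !lnM ?posrE//; first by ring.
  by apply: prodr_gt0 => i _.
by apply: prodr_gt0 => e _; exact: bernoulli_argmax_gt0.
Qed.

Let latent_le : ln (latent_prob theta z) - ln (latent_prob elbo_argmax z) <=
  \sum_i (prop theta (z i) / prop elbo_argmax (z i) - 1).
Proof. exact: ln_prodB_le. Qed.

Let cond_le : ln (cond_prob M theta Y z) - ln (cond_prob M elbo_argmax Y z) <=
  \sum_(e : {set 'I_n} | (2 <= #|e| <= M)%N)
    (bernoulli_pmf (conn theta [tuple of [seq z i | i in e]]) (Y e) /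
     bernoulli_pmf (conn elbo_argmax [tuple of [seq z i | i in e]]) (Y e) - 1).
Proof. by apply: ln_prodB_le => // e _; exact: bernoulli_argmax_gt0. Qed.

Lemma log_ratio_le : log_ratio z <= linear_ratio z.
Proof. by rewrite log_ratioE linear_ratioE lerD. Qed.

(** The latent and conditional parts each satisfy the inequality, so equality of the totals forces
    it in both parts, hence in every factor. *)
Lemma log_ratio_eq : log_ratio z = linear_ratio z ->
  (forall i, prop theta (z i) = prop elbo_argmax (z i)) /\
  (forall e : {set 'I_n}, (2 <= #|e| <= M)%N ->
     conn theta [tuple of [seq z i | i in e]] =
     conn elbo_argmax [tuple of [seq z i | i in e]]).
Proof.
rewrite log_ratioE linear_ratioE => eq_log.
have eq_latent : ln (latent_prob theta z) - ln (latent_prob elbo_argmax z) =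
    \sum_i (prop theta (z i) / prop elbo_argmax (z i) - 1).
  by apply/eqP; rewrite eq_le latent_le/=; move: cond_le eq_log; lra.
split=> [i|e eM]; first exact: (ln_prodB_eq _ _ eq_latent).
have /ln_prodB_eq : ln (cond_prob M theta Y z) - ln (cond_prob M elbo_argmax Y z) =
  \sum_(e : {set 'I_n} | (2 <= #|e| <= M)%N)
    (bernoulli_pmf (conn theta [tuple of [seq z i | i in e]]) (Y e) /
     bernoulli_pmf (conn elbo_argmax [tuple of [seq z i | i in e]]) (Y e) - 1).
  by move: eq_log; rewrite eq_latent => /addrI.
move=> /(_ bern_gt0 (fun e _ => bernoulli_argmax_gt0 e z_gt0) e eM).
(* The probability of either single outcome determines a Bernoulli parameter. *)
by rewrite /bernoulli_pmf; case: (Y e) => // /addrI/oppr_inj.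
Qed.

End Support.

(** * Averaging over all labellings *)

Hypothesis joint_gt0 : forall z, 0 < var_prob tau z -> 0 < joint_prob M theta Y z.

Let support_le z :
  var_prob tau z * log_ratio z <= var_prob tau z * linear_ratio z.
Proof.
have [z0|] := ltP 0 (var_prob tau z).
  by rewrite ler_pM2l// log_ratio_le ?joint_gt0.
by move=> z0; have -> : var_prob tau z = 0; rewrite ?mul0r//;
  apply/eqP; rewrite eq_le z0 var_prob_ge0.
Qed.

Let sum_log_ratio : \sum_z var_prob tau z * log_ratio z =
  \sum_z var_prob tau z * ln (joint_prob M theta Y z) -
  \sum_z var_prob tau z * ln (joint_prob M elbo_argmax Y z).
Proof. by rewrite -sumrB; apply: eq_bigr => z _; rewrite mulrBr. Qed.

Lemma expected_log_joint_le :
  \sum_z var_prob tau z * ln (joint_prob M theta Y z) <=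
  \sum_z var_prob tau z * ln (joint_prob M elbo_argmax Y z).
Proof.
rewrite -subr_le0 -sum_log_ratio; apply: le_trans expected_linear_ratio_le0.
by apply: ler_sum => z _; exact: support_le.
Qed.

(** The weighted gaps between linearized and logarithmic ratios are nonnegative with total at most
    0, so the gap at [z] vanishes. *)
Lemma expected_log_joint_eq z : 0 < var_prob tau z ->
  \sum_z var_prob tau z * ln (joint_prob M elbo_argmax Y z) <=
  \sum_z var_prob tau z * ln (joint_prob M theta Y z) ->
  (forall i, prop theta (z i) = prop elbo_argmax (z i)) /\
  (forall e : {set 'I_n}, (2 <= #|e| <= M)%N ->
     conn theta [tuple of [seq z i | i in e]] =
     conn elbo_argmax [tuple of [seq z i | i in e]]).
Proof.
move=> z0; rewrite -subr_ge0 -sum_log_ratio => ge0.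
apply: log_ratio_eq => //; first exact: joint_gt0.
have gap_ge0 x : true ->
    0 <= var_prob tau x * linear_ratio x - var_prob tau x * log_ratio x.
  by move=> _; rewrite subr_ge0.
have /(psumr_eq0P gap_ge0)/(_ z isT)/eqP :
    \sum_x (var_prob tau x * linear_ratio x - var_prob tau x * log_ratio x) = 0.
  apply/eqP; rewrite eq_le sumr_ge0// andbT sumrB subr_le0.
  exact: le_trans expected_linear_ratio_le0 ge0.
by rewrite subr_eq0 => /eqP/(mulfI (lt0r_neq0 z0))/esym.
Qed.

End Comparison.

(** * Extended-real values of the lower bound and optimality of the closed form *)

Lemma joint_prob_ge0 (theta : hsbm_param R Q) z :
  is_hsbm_param M theta -> 0 <= joint_prob M theta Y z.
Proof.
move=> [prop_ge0 _ conn01 _]; rewrite mulr_ge0 ?prodr_ge0// => e eM.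
by rewrite bernoulli_pmf_ge0 ?conn01.
Qed.

(** Off the support both summands are 0, whatever the value of the logarithm there. *)
Lemma var_expectation_fin (f : {ffun 'I_n -> 'I_Q} -> R) :
  (forall z, 0 < var_prob tau z -> 0 < f z) ->
  var_expectation tau (fun z => lne (f z)%:E) =
  (\sum_z var_prob tau z * ln (f z))%:E.
Proof.
move=> f0; rewrite /var_expectation -sumEFin; apply: eq_bigr => z _.
have := var_prob_ge0 z; rewrite le_eqVlt => /orP[/eqP <-|z0].
  by rewrite mul0e mul0r.
by rewrite lne_EFin ?f0.
Qed.

Lemma var_expectation_Ny (f : {ffun 'I_n -> 'I_Q} -> R) z :
  0 < var_prob tau z -> f z = 0 ->
  var_expectation tau (fun z => lne (f z)%:E) = -oo%E.
Proof.
move=> z0 fz; apply/eqP; rewrite /var_expectation esum_eqNy.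
by apply/existsP; exists z; rewrite fz /lne lexx /= gt0_muleNy.
Qed.

Lemma elbo_fin (theta : hsbm_param R Q) :
  (forall z, 0 < var_prob tau z -> 0 < joint_prob M theta Y z) ->
  elbo M Y tau theta = (\sum_z var_prob tau z * ln (joint_prob M theta Y z) -
    \sum_z var_prob tau z * ln (var_prob tau z))%:E.
Proof. by move=> joint_gt0; rewrite /elbo !var_expectation_fin. Qed.

Lemma elbo_Ny (theta : hsbm_param R Q) z :
  0 < var_prob tau z -> joint_prob M theta Y z = 0 ->
  elbo M Y tau theta = -oo%E.
Proof.
by move=> z0 jz; rewrite /elbo (var_expectation_Ny z0 jz) var_expectation_fin.
Qed.

Lemma elbo_gtNy (theta : hsbm_param R Q) :
  is_hsbm_param M theta -> (-oo < elbo M Y tau theta)%E ->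
  forall z, 0 < var_prob tau z -> 0 < joint_prob M theta Y z.
Proof.
move=> thetaP fin z z0; rewrite lt_def joint_prob_ge0// andbT.
by apply: contraTneq fin => jz; rewrite (elbo_Ny z0 jz) ltxx.
Qed.

Lemma elbo_argmax_maximizes : maximizes_elbo M Y tau elbo_argmax.
Proof.
split=> [|theta thetaP]; first exact: is_hsbm_param_argmax.
(* A competitor of value [-oo] is dominated trivially; otherwise its joint probability is positive
   on the whole support. *)
have [|fin] := leP (elbo M Y tau theta) -oo%E.
  by rewrite leeNy_eq => /eqP ->; rewrite leNye.
have joint_gt0 := elbo_gtNy thetaP fin.
rewrite !elbo_fin//; last exact: joint_argmax_gt0.
by rewrite lee_fin lerD2r expected_log_joint_le.
Qed.

(** * Every maximizer has the closed form *)

Section Maximizer.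
Variable theta : hsbm_param R Q.
Hypothesis theta_max : maximizes_elbo M Y tau theta.

Let maximizer_agrees z : 0 < var_prob tau z ->
  (forall i, prop theta (z i) = prop elbo_argmax (z i)) /\
  (forall e : {set 'I_n}, (2 <= #|e| <= M)%N ->
     conn theta [tuple of [seq z i | i in e]] =
     conn elbo_argmax [tuple of [seq z i | i in e]]).
Proof.
have [thetaP max] := theta_max.
have := max _ is_hsbm_param_argmax; rewrite (elbo_fin joint_argmax_gt0) => le_max.
have joint_gt0 := elbo_gtNy thetaP (lt_le_trans (ltNyr _) le_max).
move: le_max; rewrite elbo_fin// lee_fin lerD2r => le_max z0.
exact: expected_log_joint_eq.
Qed.

(** Agreement on the support reaches only groups of positive estimated proportion. For the others
    the estimate is 0, so all differences are nonnegative, and they sum to 1 - 1. *)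
Lemma maximizer_prop q : prop theta q = prop elbo_argmax q.
Proof.
have [[prop_ge0 prop_sum1 _ _] _] := theta_max.
have [arg_ge0 arg_sum1 _ _] := is_hsbm_param_argmax.
have agree r : 0 < prop elbo_argmax r -> prop theta r = prop elbo_argmax r.
  rewrite /= pmulr_rgt0 ?invr_gt0 ?ltr0n// => /lt0r_neq0/eqP.
  case/psumr_neq0P => [i _|i /= t0]; first exact: tau_ge0.
  have [|z z0 [zi]] := @exists_var_prob_gt0 1 [tuple i] [tuple r] isT.
    by rewrite /tau_weight big_ord1.
  by have [+ _] := maximizer_agrees z0 => /(_ i); rewrite zi.
have diff_ge0 r : true -> 0 <= prop theta r - prop elbo_argmax r.
  move=> _; rewrite subr_ge0; have := arg_ge0 r.
  by rewrite le_eqVlt => /orP[/eqP <-//|/agree ->].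
apply/eqP; rewrite -subr_eq0; apply/eqP.
by apply: (psumr_eq0P diff_ge0) => //; rewrite sumrB prop_sum1 arg_sum1 subrr.
Qed.

(** A nonzero denominator has a node tuple of positive weight, hence a labelling in the support
    giving these nodes the groups [q]. *)
Lemma maximizer_conn m (q : m.-tuple 'I_Q) : (2 <= m <= M)%N ->
  conn_den tau q != 0 -> conn theta q = conn elbo_argmax q.
Proof.
move=> mM /eqP/psumr_neq0P[i _|i /andP[ui w0]]; first exact: tau_weight_ge0.
have [z z0 zq] := exists_var_prob_gt0 ui w0.
have iM : (2 <= #|[set j in i]| <= M)%N by rewrite card_set_uniq.
have [_ /(_ _ iM)] := maximizer_agrees z0.
have zi_q : perm_eq [tuple of [seq z k | k in [set j in i]]] q.
  by rewrite -zq perm_map// perm_eq_enum_set.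
rewrite (conn_perm is_hsbm_param_argmax mM zi_q).
by rewrite (conn_perm theta_max.1 mM zi_q).
Qed.

End Maximizer.

(** * Every parameter of the closed form is a maximizer *)

(** Only entries met on the support affect the lower bound, and their denominators are positive, so
    its value equals that at [elbo_argmax]. *)
Lemma maximizes_elbo_closed_form (theta : hsbm_param R Q) : is_hsbm_param M theta ->
  (forall q, prop theta q = prop elbo_argmax q) ->
  (forall m (q : m.-tuple 'I_Q), (2 <= m <= M)%N -> sorted <=%O q ->
     conn_den tau q != 0 -> conn theta q = conn elbo_argmax q) ->
  maximizes_elbo M Y tau theta.
Proof.
move=> thetaP eq_prop eq_conn; split=> // theta' theta'P.
suff -> : elbo M Y tau theta = elbo M Y tau elbo_argmax.
  by case: elbo_argmax_maximizes => _; exact.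
rewrite /elbo /var_expectation; congr (_ - _)%E; apply: eq_bigr => z _.
have := var_prob_ge0 z; rewrite le_eqVlt => /orP[/eqP <-|z0].
  by rewrite !mul0e.
congr (_ * lne _%:E)%E; congr (_ * _).
  by apply: eq_bigr => i _; exact: eq_prop.
apply: eq_bigr => e eM; congr (bernoulli_pmf _ _).
pose q := [tuple of [seq z i | i in e]].
(* Sorting [q] reaches the nondecreasing representative for which the closed form is assumed. *)
have sq : perm_eq [tuple of sort <=%O q] q by rewrite /= perm_sort.
rewrite -/q -(conn_perm thetaP eM sq) -(conn_perm is_hsbm_param_argmax eM sq).
apply: eq_conn => //; first exact: sort_le_sorted.
rewrite (conn_den_perm sq) gt_eqF//.
have -> : q = map_tuple z (enum_tuple e) by apply: val_inj.
by apply: conn_den_map_gt0 => //; exact: enum_uniq.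
Qed.

End Estimator.

Theorem proposition5 (R : realType) (n Q M : nat)
  (tau : 'M[R]_(n, Q)) (Y : {set 'I_n} -> bool)
  (n_gt0 : (0 < n)%N) (M_ge2 : (2 <= M)%N)
  (tau01 : forall i q, 0 <= tau i q <= 1)
  (tau_sum1 : forall i, \sum_q tau i q = 1) :
  (exists theta : hsbm_param R Q, maximizes_elbo M Y tau theta) /\
  (forall theta : hsbm_param R Q, is_hsbm_param M theta ->
     (maximizes_elbo M Y tau theta <->
      (forall q, prop theta q = n%:R^-1 * \sum_i tau i q) /\
      (forall m (q : m.-tuple 'I_Q), (2 <= m <= M)%N -> sorted <=%O q ->
         conn_den tau q != 0 ->
         conn theta q = conn_num Y tau q / conn_den tau q))).
Proof.
split; first by exists (elbo_argmax tau Y); exact: elbo_argmax_maximizes.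
move=> theta thetaP; split=> [theta_max|[eq_prop eq_conn]].
  split=> [q|m q mM _ dn0].
    exact: (maximizer_prop n_gt0 tau01 tau_sum1 theta_max).
  exact: (maximizer_conn n_gt0 tau01 tau_sum1 theta_max).
exact: (maximizes_elbo_closed_form n_gt0 tau01 tau_sum1 thetaP).
Qed.
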